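(* Let $K$ be a nonempty compact metric space and let $(\Phi,\|\cdot\|_\infty)$ be a closed Banach subspace of $(C(K),\|\cdot\|_\infty)$ which separates the points of $K$ and contains the constants. Then $$w^*\mathrm{Exp}(B_{\Phi^*})=\pm\delta(\Phi\mathrm{Exp}(K))$$ and $$B_{\Phi^*}=\overline{\mathrm{conv}}^{w^*}\big(\pm\delta(\Phi\mathrm{Exp}(K))\big).$$
   Context: $(C(K),\|\cdot\|_\infty)$ is the Banach space of real-valued continuous functions on $K$ with the sup-norm. $B_{\Phi^*}$ is the closed unit ball of the dual $\Phi^*$ of $(\Phi,\|\cdot\|_\infty)$. A point $k\in K$ is $\Phi$-exposed if there is $\varphi\in\Phi$ with $\varphi(k)>\varphi(y)$ for all $y\in K\setminus\{k\}$; $\Phi\mathrm{Exp}(K)$ is the set of such points. For $k\in K$, $\delta_k\in\Phi^*$ is the evaluation $\varphi\mapsto\varphi(k)$, and $\pm\delta(\Phi\mathrm{Exp}(K)):=\{\delta_k: k\in\Phi\mathrm{Exp}(K)\}\cup\{-\delta_k: k\in\Phi\mathrm{Exp}(K)\}$. A point $Q$ of a subset $C$ of $\Phi^*$ is weak$^*$ exposed if there is $\varphi\in\Phi$ with $Q(\varphi)>R(\varphi)$ for all $R\in C\setminus\{Q\}$; $w^*\mathrm{Exp}(C)$ is the set of such points. $\overline{\mathrm{conv}}^{w^*}$ denotes the weak$^*$ closed convex hull. *)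

(* Defs.v *)
From HB Require Import structures.
From mathcomp Require Import all_boot all_order all_algebra.
From mathcomp Require Import all_classical all_reals all_analysis.

Set Implicit Arguments.
Unset Strict Implicit.
Unset Printing Implicit Defensive.

Import Order.TTheory GRing.Theory Num.Theory.
Import numFieldNormedType.Exports.

Local Open Scope classical_set_scope.
Local Open Scope ring_scope.

Section ContinuousFunctions.
Context {R : realType} {K : topologicalType}.

Definition cts_pred : {pred K -> R^o} := mem [set f : K -> R^o | continuous f].

Lemma cts_submod_closed : submod_closed cts_pred.
Proof.
split; first by rewrite inE; exact: (@cst_continuous K R^o 0).
move=> a f g; rewrite !inE /= => cf cg x.
by apply: cvgD; [apply: cvgZr; exact: cf|exact: cg].
Qed.

HB.instance Definition _ :=
  GRing.isSubmodClosed.Build R (K -> R^o) cts_pred cts_submod_closed.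

End ContinuousFunctions.

(* The compactness proof is an argument of the type because the sup-norm is a
   norm (the supremum is finite) only on a compact space. *)
Record cfun (R : realType) (K : topologicalType) (cK : compact [set: K]) :=
  CFun { cfun_val :> K -> R^o ; _ : cfun_val \in cts_pred }.

Arguments cfun R {K} cK.

Section CK.
Context {R : realType} {K : topologicalType} (cK : compact [set: K]).

Local Notation CK := (cfun R cK).

HB.instance Definition _ := [isSub of CK for @cfun_val R K cK].
HB.instance Definition _ := [Choice of CK by <:].
HB.instance Definition _ := [SubChoice_isSubLmodule of CK by <:].

Lemma cfun_continuous (f : CK) : continuous (f : K -> R).
Proof. by have := valP f; rewrite inE. Qed.

Definition supnorm (f : CK) : R := sup [set `|f x| | x in [set: K]].

Let has_ub (f : CK) : has_ubound [set `|f x| | x in [set: K]].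
Proof.
have /compact_bounded[M [_ HM]] : compact ((f : K -> R^o) @` [set: K]).
  apply: continuous_compact => //; apply: continuous_subspaceT.
  exact: cfun_continuous.
by exists (M + 1) => _ [x _ <-]; apply: (HM (M + 1)); rewrite ?ltrDl//; exists x.
Qed.

Lemma ler_supnorm (f : CK) (x : K) : `|f x| <= supnorm f.
Proof. by apply: ub_le_sup; [exact: has_ub|exists x]. Qed.

Let supnorm_le (f : CK) (c : R) :
  0 <= c -> (forall x, `|f x| <= c) -> supnorm f <= c.
Proof.
move=> c0 fc; rewrite /supnorm.
have [->|/set0P ne] := eqVneq [set `|f x| | x in [set: K]] set0.
  by rewrite sup0.
by apply: ge_sup => // _ [x _ <-].
Qed.

Let supnorm_ge0 (f : CK) : 0 <= supnorm f.
Proof.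
rewrite /supnorm.
have [->|/set0P[_ [x _ _]]] := eqVneq [set `|f x| | x in [set: K]] set0.
  by rewrite sup0.
exact: le_trans (normr_ge0 _) (ler_supnorm f x).
Qed.

Let ler_supnormD (f g : CK) : supnorm (f + g) <= supnorm f + supnorm g.
Proof.
apply: supnorm_le => [|x]; first exact: addr_ge0.
by rewrite (le_trans (ler_normD _ _))// lerD// ler_supnorm.
Qed.

Let supnormZ_le (l : R) (f : CK) : supnorm (l *: f) <= `|l| * supnorm f.
Proof.
apply: supnorm_le => [|x]; first exact: mulr_ge0.
by rewrite normrM ler_wpM2l// ler_supnorm.
Qed.

Let supnormZ (l : R) (f : CK) : supnorm (l *: f) = `|l| * supnorm f.
Proof.
apply/eqP; rewrite eq_le supnormZ_le /=.
have [->|l0] := eqVneq l 0; first by rewrite normr0 mul0r.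
rewrite -ler_pdivlMl ?normr_gt0// -normfV.
by apply: le_trans (supnormZ_le _ _); rewrite scalerA mulVf// scale1r.
Qed.

Let supnorm0_eq0 (f : CK) : supnorm f = 0 -> f = 0.
Proof.
move=> f0; apply/val_inj/funext => x /=.
by apply/eqP; rewrite -normr_le0 -f0 ler_supnorm.
Qed.

HB.instance Definition _ := @Lmodule_isNormed.Build R CK supnorm
  ler_supnormD supnormZ supnorm0_eq0.

Lemma cfun_normE (f : CK) : `|f| = sup [set `|f x| | x in [set: K]].
Proof. by []. Qed.

Lemma cst_cts_pred (c : R) : (cst c : K -> R^o) \in cts_pred.
Proof. by rewrite inE; exact: cst_continuous. Qed.

Definition cfun_cst (c : R) : CK := CFun cK (cst_cts_pred c).

End CK.

Record submod (R : realType) (V : normedModType R) (S : submodClosed V) :=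
  SubMod { submod_val :> V ; _ : submod_val \in S }.

Section SubNormed.
Context {R : realType} {V : normedModType R} (S : submodClosed V).

HB.instance Definition _ := [isSub of submod S for @submod_val R V S].
HB.instance Definition _ := [Choice of submod S by <:].
HB.instance Definition _ := [SubChoice_isSubLmodule of submod S by <:].

Let norm (v : submod S) : R := `|val v|.

Let ler_normD' (v w : submod S) : norm (v + w) <= norm v + norm w.
Proof. exact: ler_normD. Qed.

Let normrZ' (l : R) (v : submod S) : norm (l *: v) = `|l| * norm v.
Proof. exact: normrZ. Qed.

Let normr0_eq0' (v : submod S) : norm v = 0 -> v = 0.
Proof. by move=> /normr0_eq0 v0; exact: val_inj. Qed.

HB.instance Definition _ := @Lmodule_isNormed.Build R (submod S) norm
  ler_normD' normrZ' normr0_eq0'.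

End SubNormed.

Section DualPred.
Context {R : realType} {V : normedModType R}.

Definition dual_pred : {pred V -> R^o} :=
  mem [set Q : V -> R^o | linear Q /\ continuous Q].

Lemma dual_submod_closed : submod_closed dual_pred.
Proof.
split.
  rewrite inE; split; first by move=> a u v; rewrite /= scaler0 addr0.
  exact: (@cst_continuous V R^o 0).
move=> a P Q; rewrite !inE /= => -[lP cP] [lQ cQ]; split.
  move=> b u v; rewrite /= !fctE lP lQ !scalerDr !scalerA.
  by rewrite [a * b]mulrC addrACA.
by move=> x; apply: cvgD; [apply: cvgZr; exact: cP|exact: cQ].
Qed.

HB.instance Definition _ :=
  GRing.isSubmodClosed.Build R (V -> R^o) dual_pred dual_submod_closed.

End DualPred.

Record dual (R : realType) (V : normedModType R) :=
  Dual { dual_val :> V -> R^o ; _ : dual_val \in dual_pred }.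

Section Dual.
Context {R : realType} {V : normedModType R}.

HB.instance Definition _ := [isSub of dual V for @dual_val R V].
HB.instance Definition _ := [Choice of dual V by <:].
HB.instance Definition _ := [SubChoice_isSubLmodule of dual V by <:].

(* The topology put on [dual V] is the weak* one (pointwise convergence on [V]),
   not the one of [dual_norm]. *)
HB.instance Definition _ := Topological.copy (dual V)
  (initial_topology (@dual_val R V : dual V -> {ptws V -> R^o})).

Definition dual_norm (Q : dual V) : R :=
  sup [set `|Q v| | v in [set v : V | `|v| <= 1]].

Definition dual_ball : set (dual V) := [set Q | dual_norm Q <= 1].

Definition wstar_exposed (C : set (dual V)) : set (dual V) :=
  [set Q | C Q /\ exists v : V, forall P, (C `\ Q) P -> P v < Q v].

Definition conv_hull (A : set (dual V)) : set (dual V) :=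
  smallest (@convex_set R (dual V)) A.

Definition wstar_closed_conv_hull (A : set (dual V)) : set (dual V) :=
  closure (conv_hull A).

End Dual.

Arguments dual_ball {R} V _.

Section Exposed.
Context {R : realType} {K : topologicalType} {cK : compact [set: K]}.
Variable Phi : submodClosed (cfun R cK).

Definition exposed : set K :=
  [set k | exists2 phi : cfun R cK,
             phi \in Phi & forall y, y <> k -> phi y < phi k].

Lemma eval_dual_pred (k : K) :
  ((fun phi => (val phi : cfun R cK) k) : submod Phi -> R^o) \in dual_pred.
Proof.
rewrite inE.
pose e (phi : submod Phi) : R^o := (val phi : cfun R cK) k.
have e_linear : linear e by move=> a u v; rewrite /e linearP.
pose E : {linear submod Phi -> R^o} :=
  HB.pack e (GRing.isLinear.Build _ _ _ _ _ e_linear).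
split; first by [].
apply: (@bounded_linear_continuous _ _ _ E).
apply/linear_boundedP; near=> r => phi /=.
apply: (@le_trans _ _ (1 * `|phi|)).
  by rewrite mul1r; exact: (ler_supnorm (val phi) k).
by rewrite ler_wpM2r.
Unshelve. all: by end_near. Qed.

Definition delta (k : K) : dual (submod Phi) := Dual (eval_dual_pred k).

Definition pm_delta (A : set K) : set (dual (submod Phi)) :=
  [set delta k | k in A] `|` [set - delta k | k in A].

End Exposed.

Arguments delta {R K cK} Phi k.
Arguments pm_delta {R K cK} Phi A _.

(* Main.v *)
From HB Require Import structures.
Require Import Defs.
From mathcomp Require Import all_boot all_order all_algebra.
From mathcomp Require Import all_classical all_reals all_analysis.
From mathcomp Require Import ring lra.

(** The description of the ball as a closed convex hull rests on one fact: the
    exposed points of [K] are norming, in the sense that [f x - eps <= f k] for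
    some exposed [k], given [f] in [Phi], [x] in [K] and [0 < eps]
    ([exposed_almost_max]).

    This follows from a density statement of Mazur's type: the functions of
    [Phi] with a strict maximum are dense in [Phi] ([strict_max_dense]).  Fix
    [f] and [g] and let [M t] be the maximum of [f + t g].  An almost-maximiser
    [x] of [f + t g] competes at [t + h] and at [t - h], so [g x] is almost
    squeezed between the two difference quotients of [M] at [t]; the
    oscillation of [g] over the almost-maximisers is thus almost bounded by a
    second difference of [M] divided by [h].  Over a grid of step [h] the second
    differences telescope to at most [2 h |g|], so one of them is small relative
    to [h] if the grid is fine ([small_oscillation]).  By compactness and
    separation, finitely many [g] in [Phi] distinguish all pairs of points at
    distance at least [1 / n]; perturbing successively along them yields a
    function none of whose pairs of almost-maximisers are that far apart.  This
    condition is open, [Phi] is complete, and Baire's theorem combines the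
    conditions for all [n].

    To pass to the convex hull, take [Q] in the ball and finitely many vectors.
    The squared Euclidean distance from [Q] to the hull on these vectors is
    driven to [0] by the Frank-Wolfe scheme, which makes a separation theorem
    unnecessary: the gradient at a point of the hull is, up to a factor,
    evaluation at some vector [phi], and a norming family has an element [P]
    with [Q phi - P phi] arbitrarily small, towards which one moves
    ([norming_hull_approx]).

    As for the weak* exposed points, a functional exposed by [phi] must coincide
    with [delta k] or [- delta k] at a point [k] where [phi] attains its norm,
    and separation makes [k] exposed.  Conversely, if [g >= 1] has a strict
    maximum at [k], then the norm is differentiable at [g] with derivative
    [delta k] ([strict_max_directional]), so that [delta k] is the only
    functional of the ball that is norming for [g]; the constants in [Phi]
    provide the bound [g >= 1]. *)

Import Order.TTheory GRing.Theory Num.Theory.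
Import numFieldNormedType.Exports.

Local Open Scope classical_set_scope.
Local Open Scope ring_scope.

(** * The dual ball and weak* closed convex hulls *)

Section DualBall.
Context {R : realType} {V : normedModType R}.
Implicit Types (Q P : dual V) (v w : V).

Lemma dual_linear Q : linear (dual_val Q).
Proof. by have := valP Q; rewrite inE => -[]. Qed.

HB.instance Definition _ Q :=
  GRing.isLinear.Build R V R^o _ (dual_val Q) (dual_linear Q).

Lemma dualZ Q a v : Q (a *: v) = a * Q v.
Proof. exact: linearZ. Qed.

Lemma dual_continuous Q : continuous (dual_val Q).
Proof. by have := valP Q; rewrite inE => -[]. Qed.

(** The supremum defining the dual norm is meaningful: [sup] is [0] on an
    unbounded set, which would put unbounded functionals in the ball. *)
Lemma dual_has_ubound Q :
  has_ubound [set `|Q v| | v in [set v : V | `|v| <= 1]].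
Proof.
have /linear_boundedP[M [_ QM]] := @continuous_linear_bounded _ _ _ 0
  [the {linear V -> R^o} of dual_val Q] (dual_continuous Q 0).
exists (`|M| + 1) => _ [v v1 <-].
have /QM/(_ v)/le_trans : M < `|M| + 1.
  by rewrite (le_lt_trans (ler_norm _)) ?ltrDl.
by apply; rewrite ler_piMr // addr_ge0.
Qed.

Lemma dual_ballP Q : dual_ball V Q <-> forall v, Q v <= `|v|.
Proof.
split=> [Q1 v|Qv].
  have [->|v0] := eqVneq v 0; first by rewrite linear0 normr0.
  have nv : 0 < `|v| by rewrite normr_gt0.
  suff : `|v|^-1 * Q v <= 1 by rewrite ler_pdivrMl // mulr1.
  apply: le_trans Q1; apply: le_trans (ler_norm _) _.
  apply: (ub_le_sup (dual_has_ubound Q)).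
  exists (`|v|^-1 *: v); last by rewrite linearZ.
  by rewrite /= normrZ normfV normr_id mulVf // gt_eqF.
apply: ge_sup; first by exists `|Q 0|, 0; rewrite //= normr0.
move=> _ [v v1 <-]; apply: le_trans v1.
by rewrite ler_norml Qv andbT lerNl -linearN -(normrN v) Qv.
Qed.

Lemma dual_ballN Q : dual_ball V Q -> dual_ball V (- Q).
Proof.
move=> /dual_ballP BQ; apply/dual_ballP => v.
have -> : (- Q) v = Q (- v) by rewrite linearN.
by rewrite -(normrN v).
Qed.

Lemma eval_wstar_continuous v : continuous (fun Q : dual V => Q v : R^o).
Proof.
move=> Q.
apply: (@cvg_comp _ _ _ (@dual_val R V : dual V -> {ptws V -> R^o})
  (@proj V (fun=> R^o) v) _ (nbhs (dual_val Q : {ptws V -> R^o}))).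
  exact: initial_continuous.
exact: (@proj_continuous V (fun=> R^o)).
Qed.

(** Convergence of filters, rather than a base of neighbourhoods, gives
    access to the weak* topology without unfolding the product topology. *)
Lemma wstar_cvg (F : set_system (dual V)) Q : Filter F ->
  (forall v, (fun P => P v) @ F --> Q v) -> F --> Q.
Proof.
move=> FF FQ A [_ [[B oB <-] BQ] BA].
have /(_ B) : (@dual_val R V : dual V -> {ptws V -> R^o}) @ F -->
    (dual_val Q : {ptws V -> R^o}).
  pose G : set_system {ptws V -> R^o} :=
    (@dual_val R V : dual V -> {ptws V -> R^o}) @ F.
  have FG : Filter G by exact: fmap_filter.
  exact: ((@pointwise_cvgP V R^o G (dual_val Q) FG).2 FQ).
by move=> /(_ (open_nbhs_nbhs (conj oB BQ))); exact: (filterS BA).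
Qed.


Lemma dual_ball_wstar_closed (C : set (dual V)) :
  C `<=` dual_ball V -> closure C `<=` dual_ball V.
Proof.
move=> CB Q clQ; apply/dual_ballP => v; rewrite leNgt; apply/negP => Qv.
have : nbhs Q [set P : dual V | `|v| < P v].
  exact: (eval_wstar_continuous v Q _ (lt_nbhsr Qv)).
by move=> /clQ[P [/CB/dual_ballP/(_ v) + /=]]; rewrite leNgt => /negP.
Qed.

Lemma dual_ball_convex : @convex_set R (dual V) (dual_ball V).
Proof.
move=> P Q t /set_mem/dual_ballP BP /set_mem/dual_ballP BQ.
apply/mem_set/dual_ballP => v.
have -> : (conv t P Q : dual V) v = t%:num * P v + (1 - t%:num) * Q v by [].
have t0 : 0 <= t%:num by [].
have t1 : 0 <= 1 - t%:num by rewrite subr_ge0 le1.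
rewrite -[leRHS]mul1r -[1 in leRHS](subrKC t%:num) [leRHS]mulrDl.
by apply: lerD; rewrite ler_wpM2l.
Qed.

(** The hull is used only through segments, the moves of the Frank-Wolfe
    scheme. *)
Lemma conv_hull_segment (A : set (dual V)) P Q (s : R) :
  0 <= s <= 1 -> conv_hull A P -> conv_hull A Q ->
  conv_hull A ((1 - s) *: P + s *: Q).
Proof.
move=> /andP[s0 s1] hP hQ C [cC AC].
have /set_mem := cC Q P (Itv01 s0 s1) (mem_set (hQ C (conj cC AC)))
  (mem_set (hP C (conj cC AC))).
by rewrite addrC.
Qed.

Lemma sub_conv_hull (A : set (dual V)) : A `<=` conv_hull A.
Proof. exact: sub_smallest. Qed.

Lemma conv_hull_dual_ball (A : set (dual V)) :
  A `<=` dual_ball V -> conv_hull A `<=` dual_ball V.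
Proof. by move=> AB; apply: smallest_sub => //; exact: dual_ball_convex. Qed.

Section FrankWolfe.
Variables (A : set (dual V)) (Q : dual V) (s : seq V).
Hypothesis (AB : A `<=` dual_ball V).
Hypothesis (A_norming : forall v e, 0 < e -> exists2 P, A P & `|v| - e <= P v).
Hypothesis (BQ : dual_ball V Q).

Let D P : R := \sum_(v <- s) (Q v - P v) ^+ 2.

Let B : R := \sum_(v <- s) (2 * `|v|) ^+ 2.

Let sqdist_le P : dual_ball V P -> D P <= B.
Proof.
move=> BP; apply: ler_sum => v _.
rewrite -real_normK ?num_real // lerXn2r ?nnegrE ?mulr_ge0 //.
have abs_le S : dual_ball V S -> `|S v| <= `|v|.
  move=> /dual_ballP BS.
  by rewrite ler_norml BS andbT lerNl -linearN -(normrN v) BS.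
by rewrite (le_trans (ler_normB _ _)) // mulr2n mulrDl mul1r lerD ?abs_le.
Qed.

(** [D] is quadratic, and half its derivative at [P0] towards [P] is
    [Q phi - P phi - D P0] for the vector [phi] below; a point [P] of [A] almost
    norming [phi] makes [Q phi - P phi] at most [e]. *)
Let sqdist_step P0 t e : 0 <= t <= 1 -> 0 < e -> conv_hull A P0 ->
  exists2 P, conv_hull A P &
    D P <= (1 - t) ^+ 2 * D P0 + 2 * t * e + t ^+ 2 * B.
Proof.
move=> t01 e0 hP0; have /andP[t0 t1] := t01.
pose phi : V := \sum_(v <- s) (Q v - P0 v) *: v.
have [P AP Pphi] := A_norming phi e e0.
exists ((1 - t) *: P0 + t *: P).
  by apply: conv_hull_segment => //; exact: sub_conv_hull.
have cross : \sum_(v <- s) (Q v - P0 v) * (Q v - P v) <= e.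
  have -> : \sum_(v <- s) (Q v - P0 v) * (Q v - P v) = Q phi - P phi.
    rewrite /phi !linear_sum -big_split; apply: eq_bigr => v _.
    by rewrite /= !dualZ mulrBr.
  by rewrite lerBlDr -lerBlDl (le_trans _ Pphi)// lerD2r (dual_ballP Q).1.
have -> : D ((1 - t) *: P0 + t *: P) = (1 - t) ^+ 2 * D P0 +
    2 * t * (1 - t) * (\sum_(v <- s) (Q v - P0 v) * (Q v - P v)) +
    t ^+ 2 * D P.
  rewrite /D !mulr_sumr -!big_split; apply: eq_bigr => v _.
  have -> : ((1 - t) *: P0 + t *: P) v = (1 - t) * P0 v + t * P v by [].
  by rewrite /=; ring.
apply: lerD; last by rewrite ler_wpM2l ?sqr_ge0// sqdist_le//; exact: AB.
rewrite lerD2l; apply: (@le_trans _ _ (2 * t * (1 - t) * e)).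
  by rewrite ler_wpM2l // !mulr_ge0 // subr_ge0.
by rewrite (ler_wpM2r (ltW e0)) // ler_piMr ?mulr_ge0 // gerBl.
Qed.

(** If the infimum [d] of [D] over the hull were positive, one step of size
    [d / (d + B)] from a point close to the infimum would fall below it. *)
Lemma norming_hull_approx e : 0 < e ->
  exists2 P, conv_hull A P & forall v, v \in s -> `|P v - Q v| < e.
Proof.
move=> e0.
pose S := D @` conv_hull A.
have S0 : S !=set0.
  have [P AP _] := A_norming 0 1 ltr01.
  by exists (D P), P => //; exact: sub_conv_hull.
have D0 P : 0 <= D P by apply: sumr_ge0 => v _; exact: sqr_ge0.
have Slb : lbound S 0 by move=> _ [P _ <-].
have iS : has_inf S by split => //; exists 0.
have B0 : 0 <= B by apply: sumr_ge0 => v _; exact: sqr_ge0.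
have infS : inf S <= 0.
  rewrite leNgt; apply/negP => d0; set d := inf S in d0.
  (* This [t] minimises the main terms: [(1 - t)^2 d + t^2 B] is then
     [d - t d], which leaves [t d] to be shared between the two errors. *)
  pose t := d / (d + B).
  have dB : 0 < d + B by rewrite ltr_wpDr.
  have t0 : 0 < t by rewrite divr_gt0.
  have t1 : t <= 1 by rewrite ler_pdivrMr // mul1r lerDl.
  have tdB : t * (d + B) = d by rewrite divfK // gt_eqF.
  have [_ [P0 hP0 <-] DP0] :=
    inf_adherent (divr_gt0 (mulr_gt0 t0 d0) (ltr0n R 4)) iS.
  have t01 : 0 <= t <= 1 by rewrite ltW.
  have [P hP DP] := sqdist_step P0 t (d / 4) t01 (divr_gt0 d0 (ltr0n R 4)) hP0.
  have : d <= D P by apply: (ge_inf iS.2); exists P.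
  apply/negP; rewrite -ltNge; apply: le_lt_trans DP _.
  have td : 0 < t * d by rewrite mulr_gt0.
  have q1 : (1 - t) ^+ 2 * D P0 <= (1 - t) ^+ 2 * d + t * d / 4.
    have h1 : (1 - t) ^+ 2 <= 1 by rewrite expr_le1 // ?subr_ge0 // gerBl ltW.
    have h2 : 0 <= (1 - t) ^+ 2 by rewrite sqr_ge0.
    apply: (@le_trans _ _ ((1 - t) ^+ 2 * (d + t * d / 4))).
      by rewrite ler_wpM2l // ltW.
    by rewrite mulrDr lerD2l ler_piMl // ltW // divr_gt0.
  have q2 : t ^+ 2 * d + t ^+ 2 * B = t * d by rewrite -mulrDr expr2 -mulrA tdB.
  nra.
have [_ [P hP <-] DP] := inf_adherent (exprn_gt0 2 e0) iS.
exists P => // v vs; rewrite distrC.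
rewrite -(@ltr_pXn2r _ 2) ?nnegrE ?(ltW e0) // real_normK ?num_real //.
apply: le_lt_trans (lt_le_trans DP _); last by rewrite gerDr.
rewrite /D (big_rem v vs) /= lerDl; apply: sumr_ge0 => w _; exact: sqr_ge0.
Qed.

End FrankWolfe.

(** Finite approximations assemble into a filter on the hull that converges to
    [Q] weak*. *)
Lemma norming_closed_hull (A : set (dual V)) :
  A `<=` dual_ball V ->
  (forall v e, 0 < e -> exists2 P, A P & `|v| - e <= P v) ->
  dual_ball V = wstar_closed_conv_hull A.
Proof.
move=> AB A_norming; apply/seteqP; split => [Q BQ|]; last first.
  exact/dual_ball_wstar_closed/conv_hull_dual_ball.
pose near_Q (se : seq V * R) :=
  [set P | conv_hull A P /\ forall v, v \in se.1 -> `|P v - Q v| < se.2].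
pose F := filter_from [set se : seq V * R | 0 < se.2] near_Q.
have FF : ProperFilter F.
  apply: filter_from_proper; last first.
    move=> [s e] /= e0.
    have [P hP Ps] := norming_hull_approx A Q s AB A_norming BQ e e0.
    by exists P.
  apply: filter_from_filter; first by exists ([::], 1) => /=.
  move=> [s1 e1] [s2 e2] /= e10 e20.
  exists (s1 ++ s2, Num.min e1 e2); first by rewrite /= lt_min e10 e20.
  move=> P [/= hP Ps]; split; split => //= v vs.
    by have := Ps v; rewrite mem_cat vs lt_min => /(_ isT)/andP[].
  by have := Ps v; rewrite mem_cat vs orbT lt_min => /(_ isT)/andP[].
have FQ : F --> Q.
  apply: wstar_cvg => v; apply/cvgrPdist_lt => e e0.
  by exists ([:: v], e) => // P [_ /= Pv]; rewrite /= distrC Pv // mem_head.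
move=> N /FQ FN; apply: (@filter_ex _ F); apply: filterI => //.
by exists ([::], 1) => //= P [].
Qed.

End DualBall.

(** * Perturbing a continuous function to shrink its set of maximisers *)

Section ContinuousFunctionsOnCompact.
Context {R : realType} {K : topologicalType} {cK : compact [set: K]}.
Local Notation CK := (cfun R cK).
Implicit Types (f g : CK) (x y : K).

Lemma cfun_norm_le f c : 0 <= c -> (forall x, `|f x| <= c) -> `|f| <= c.
Proof.
move=> c0 fc; rewrite cfun_normE.
have [->|/set0P ne] := eqVneq [set `|f x| | x in [set: K]] set0.
  by rewrite sup0.
by apply: ge_sup => // _ [x _ <-].
Qed.

Lemma cfun_le_norm f x : `|f x| <= `|f|.
Proof. exact: ler_supnorm. Qed.

Lemma cfun_argmax f : [set: K] !=set0 -> exists x, forall y, f y <= f x.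
Proof.
move=> K0; have cf : {within [set: K], continuous (f : K -> R)}.
  by apply: continuous_subspaceT; exact: cfun_continuous.
have [x _ fx] := compact_EVT_max K0 cK cf.
by exists x => y; apply: fx; rewrite inE.
Qed.

(** Comparing with all values, without naming the maximum, makes perturbation
    estimates pointwise. *)
Definition near_max f (d : R) : set K := [set x | forall y, f y <= f x + d].

Lemma near_max_perturb f g e d :
  `|g - f| <= e -> near_max g d `<=` near_max f (d + 2 * e).
Proof.
move=> gf x gx y.
have := le_trans (cfun_le_norm (g - f) x) gf.
have := le_trans (cfun_le_norm (g - f) y) gf.
rewrite !ler_norml.
have -> : (g - f) x = g x - f x by [].
have -> : (g - f) y = g y - f y by [].
by have := gx y; lra.
Qed.

(** Let [M t] be the maximum of [f + t g].  It is Lipschitz in [t], so its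
    second differences over a grid of step [h] telescope to at most [2 h `|g|],
    however many grid points there are.  Where the second difference is small,
    the values at [t + h] and [t - h] pin down [g] on the almost-maximisers of
    [f + t g], since these compete for both. *)
Lemma small_oscillation f g (eta eps : R) : [set: K] !=set0 ->
  0 < eta -> 0 < eps -> exists t d : R, [/\ 0 < t < eps, 0 < d &
    forall x y, near_max (f + t *: g) d x -> near_max (f + t *: g) d y ->
      g x - g y <= eta].
Proof.
move=> K0 eta0 eps0.
have E t x : (f + t *: g) x = f x + t * g x by [].
have /choice[M MP] : forall t : R, exists m : R,
    (forall x, f x + t * g x <= m) /\ exists x, m = f x + t * g x.
  move=> t; have [x xmax] := cfun_argmax (f + t *: g) K0.
  by exists (f x + t * g x); split; [exact: xmax|exists x].
have MB t s : M s - M t <= `|s - t| * `|g|.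
  have [_ [x ->]] := MP s; have [/(_ x) Mt _] := MP t.
  have : (s - t) * g x <= `|s - t| * `|g|.
    rewrite (le_trans (ler_norm _)) // normrM; apply: ler_wpM2l => //.
    exact: cfun_le_norm.
  by rewrite mulrBl; lra.
(* [N] grid points share the total [2 h `|g|], so one second difference is at
   most [h eta / 2]; the slack [d] uses up the other half of [eta]. *)
pose N := (Num.truncn (4 * `|g| / eta)).+1.
have NE : 4 * `|g| < eta * N%:R.
  by rewrite [ltRHS]mulrC -ltr_pdivrMr // truncnS_gt.
pose h := eps / N.+1%:R.
have h0 : 0 < h by rewrite divr_gt0.
pose u j := M (j.+1%:R * h) - M (j%:R * h).
have [j jN uj] : exists2 j, (j < N)%N & u j.+1 - u j <= eta / 2 * h.
  apply: contrapT => noj.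
  have : eta / 2 * h * N%:R <= u N - u 0%N.
    rewrite -(telescope_sumr _ (leq0n N)) mulr_natr.
    rewrite -[X in _ *+ X]subn0 -sumr_const_nat; apply: ler_sum_nat => j /= jN.
    by rewrite leNgt; apply/negP => /ltW uj; apply: noj; exists j.
  have u1 : u N <= h * `|g|.
    by rewrite (le_trans (MB _ _)) // -mulrBl -natrB // subSnn mul1r gtr0_norm.
  have u0 : - u 0%N <= h * `|g|.
    rewrite opprB (le_trans (MB _ _)) // !(mul0r, mul1r) sub0r normrN.
    by rewrite gtr0_norm.
  have := mulr_gt0 h0 eta0; have := ler_wpM2l (ltW h0) (ltW NE).
  have : h * (4 * `|g|) < h * (eta * N%:R) by rewrite ltr_pM2l.
  by lra.
exists (j.+1%:R * h), (eta * h / 4).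
split.
- rewrite mulr_gt0 //= /h mulrCA gtr_pMr // ltr_pdivrMr // mul1r ltr_nat.
  by rewrite ltnS.
- by rewrite divr_gt0 // mulr_gt0.
move=> x y; set t := j.+1%:R * h => nx ny.
have tp : t + h = j.+2%:R * h by rewrite /t -[in RHS]natr1 mulrDl mul1r.
have tm : t - h = j%:R * h by rewrite /t -natr1 mulrDl mul1r addrK.
have [_ [z Mt]] := MP t.
have := nx z; have := ny z; rewrite !E -Mt => ny' nx'.
have [/(_ x) Mx _] := MP (t + h); have [/(_ y) My _] := MP (t - h).
move: uj; rewrite /u -tp -/t -tm => uj.
rewrite -(ler_pM2l h0); nra.
Qed.

(** The positive tolerance [d] leaves room to perturb [f]. *)
Definition max_separates (A : set (K * K)) f := exists2 d : R, 0 < d &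
  forall x y, A (x, y) -> near_max f d x -> near_max f d y -> False.

Lemma max_separates_open A f : max_separates A f ->
  exists2 r : R, 0 < r & forall g, `|g - f| < r -> max_separates A g.
Proof.
move=> [d d0 Ad]; exists (d / 4); first by rewrite divr_gt0.
move=> g /ltW gf; exists (d / 2); first by rewrite divr_gt0.
have dE : d / 2 + 2 * (d / 4) = d by field.
move=> x y Axy /(near_max_perturb _ _ _ _ gf) + /(near_max_perturb _ _ _ _ gf).
by rewrite dE; exact: Ad.
Qed.

Section Subspace.
Variable Phi : submodClosed CK.
Hypothesis K0 : [set: K] !=set0.

(** Successive perturbations: each one is small enough for the oscillation
    bounds already achieved to survive, with a smaller tolerance. *)
Lemma small_oscillation_seq (s : seq CK) f (eta eps : R) :
  f \in Phi -> {subset s <= Phi} -> 0 < eta -> 0 < eps ->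
  exists f' d, [/\ f' \in Phi, `|f' - f| < eps, 0 < d &
    forall g x y, g \in s -> near_max f' d x -> near_max f' d y ->
      `|g x - g y| <= eta].
Proof.
move=> fP + eta0; elim: s eps => [|g s IH] eps sP eps0.
  by exists f, 1; split => //; rewrite subrr normr0.
have e20 : 0 < eps / 2 by rewrite divr_gt0.
have [|f1 [d1 [f1P f1f d10 osc1]]] := IH (eps / 2) _ e20.
  by move=> h hs; apply: sP; rewrite inE hs orbT.
pose c := Num.min (eps / 2) (d1 / 4).
have c0 : 0 < c by rewrite lt_min !divr_gt0.
have g0 : 0 < `|g| + 1 by rewrite ltr_wpDl.
have [t [d2 [/andP[t0 tc] d20 osc2]]] :=
  small_oscillation f1 g eta (c / (`|g| + 1)) K0 eta0 (divr_gt0 c0 g0).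
have tg : `|f1 + t *: g - f1| <= c.
  rewrite addrC addKr normrZ gtr0_norm //.
  apply: (@le_trans _ _ (t * (`|g| + 1))).
    by rewrite ler_wpM2l ?lerDl // ltW.
  by rewrite -ler_pdivlMr // ltW.
exists (f1 + t *: g), (Num.min d2 (d1 / 2)); split.
- by rewrite rpredD // rpredZ // sP // mem_head.
- have -> : f1 + t *: g - f = (f1 + t *: g - f1) + (f1 - f).
    by rewrite addrA subrK.
  rewrite (le_lt_trans (ler_normD _ _)) //.
  rewrite [ltRHS](splitr eps) ler_ltD // (le_trans tg) //.
  by rewrite /c ge_min lexx.
- by rewrite lt_min d20 divr_gt0.
have le_near a b x : a <= b ->
    near_max (f1 + t *: g) a x -> near_max (f1 + t *: g) b x.
  by move=> ab ax y; rewrite (le_trans (ax y)) // lerD2l.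
move=> h x y; rewrite inE => /orP[/eqP -> nx ny|hs nx ny].
  have nx2 := le_near _ d2 _ _ nx; have ny2 := le_near _ d2 _ _ ny.
  have le_d2 : Num.min d2 (d1 / 2) <= d2 by rewrite ge_min lexx.
  by rewrite ler_norml lerNl opprB !osc2 //; first [exact: nx2|exact: ny2].
have near1 z : near_max (f1 + t *: g) (Num.min d2 (d1 / 2)) z ->
    near_max f1 d1 z.
  have cd : Num.min d2 (d1 / 2) + 2 * c <= d1.
    have : c <= d1 / 4 by rewrite /c ge_min lexx orbT.
    have : Num.min d2 (d1 / 2) <= d1 / 2 by rewrite ge_min lexx orbT.
    by lra.
  move=> /(near_max_perturb _ _ _ _ tg) nz w.
  by rewrite (le_trans (nz w)) // lerD2l.
by apply: osc1 => //; exact: near1.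
Qed.

Hypothesis Phi_separates : forall x y, x <> y ->
  exists2 g, g \in Phi & g x <> g y.

(** [Phi] is stable under scaling, so a separating function can be normalised to
    separate by more than [1]; compactness of [A] then leaves finitely many
    functions.  The filter of finite subfamilies of [Phi], ordered by inclusion,
    turns this into the filter form of compactness. *)
Lemma finite_separation (A : set (K * K)) : compact A ->
  (forall x, ~ A (x, x)) ->
  exists2 s : seq CK, {subset s <= Phi} &
    forall x y, A (x, y) -> exists2 g, g \in s & 1 < `|g x - g y|.
Proof.
move=> /compact_near_coveringP cA offdiag.
pose F : set_system (seq CK) := filter_from [set s : seq CK | {subset s <= Phi}]
  (fun s : seq CK =>
    [set s' : seq CK | {subset s <= s'} /\ {subset s' <= Phi}]).
have FF : ProperFilter F.
  apply: filter_from_proper; last by move=> s sP; exists s; split.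
  apply: filter_from_filter; first by exists [::].
  move=> s1 s2 s1P s2P; exists (s1 ++ s2).
    by move=> g; rewrite mem_cat => /orP[/s1P|/s2P].
  move=> s [s12 sP]; split; split => // g gs; apply: s12.
    by rewrite mem_cat gs.
  by rewrite mem_cat gs orbT.
pose P (s : seq CK) (p : K * K) := exists2 g, g \in s & 1 < `|g p.1 - g p.2|.
have FP : F [set s : seq CK | {subset s <= Phi}] by exists [::] => // s [].
have : \near F, A `<=` P F.
  apply: cA => -[x y] Axy; have [|g gP gxy] := Phi_separates x y.
    by move=> xy; apply: (offdiag x); rewrite {2}xy.
  have g0 : 0 < `|g x - g y| by rewrite normr_gt0 subr_eq0; exact/eqP.
  pose g' := (2 / `|g x - g y|) *: g.
  have g'P : g' \in Phi by rewrite rpredZ.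
  have cg' := @cfun_continuous R K cK g'.
  have g'xy : 1 < `|g' x - g' y|.
    have -> : g' x - g' y = (2 / `|g x - g y|) * (g x - g y) by rewrite mulrBr.
    by rewrite normrM normf_div normr_id divfK ?gt_eqF // normr_nat ltr1n.
  have cont : {for (x, y), continuous (fun p : K * K => `|g' p.1 - g' p.2|)}.
    apply: (@cvg_norm R R^o); apply: cvgB.
      by apply: (@continuous_comp _ _ _ fst g'); [exact: cvg_fst|exact: cg'].
    by apply: (@continuous_comp _ _ _ snd g'); [exact: cvg_snd|exact: cg'].
  have near1 : \forall p \near (x, y), 1 < `|g' p.1 - g' p.2|.
    exact: (cont _ (lt_nbhsr g'xy)).
  have near2 : F [set s : seq CK | g' \in s].
    exists [:: g']; first by move=> h; rewrite inE => /eqP ->.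
    by move=> s [gs _]; apply: gs; rewrite mem_head.
  exists ([set p : K * K | 1 < `|g' p.1 - g' p.2|],
          [set s : seq CK | g' \in s]).
    by split; [exact: near1|exact: near2].
  by case=> p s [] /= ? ?; exists g'.
by move=> /(filterI FP)/filter_ex[s [sP As]]; exists s => // x y /As.
Qed.

Lemma max_separates_dense (A : set (K * K)) f (eps : R) :
  compact A -> (forall x, ~ A (x, x)) -> f \in Phi -> 0 < eps ->
  exists2 g, g \in Phi & `|g - f| < eps /\ max_separates A g.
Proof.
move=> cA offdiag fP eps0; have [s sP As] := finite_separation A cA offdiag.
have [g [d [gP gf d0 osc]]] := small_oscillation_seq s f 1 eps fP sP ltr01 eps0.
exists g => //; split => //; exists d => // x y /As[h hs hxy] nx ny.
by have := osc h x y hs nx ny; rewrite leNgt hxy.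
Qed.

End Subspace.

(** * Completeness *)

Lemma cfun_complete (F : set_system CK) : ProperFilter F -> cauchy F -> cvg F.
Proof.
move=> FF /cauchyP F_cauchy.
have near_const (e : R) : 0 < e ->
    exists f : CK, F [set g : CK | forall x, `|g x - f x| < e].
  move=> e0; have [f Ff] := F_cauchy e e0; exists f.
  apply: filterS Ff => g; rewrite -ball_normE /= distrC => gf x.
  exact: le_lt_trans (cfun_le_norm (g - f) x) gf.
have /choice[l l_lim] : forall x, exists l : R,
    (fun f : CK => f x : R) @ F --> l.
  move=> x; apply/cvg_ex; apply: R_complete; apply/cauchyP => e e0.
  have [f Ff] := near_const e e0; exists (f x).
  suff : F [set g : CK | ball (f x : R) e (g x)] by [].
  by apply: filterS Ff => g /(_ x); rewrite /= -ball_normE /= distrC.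
have l_unif (e : R) : 0 < e -> F [set g : CK | forall x, `|g x - l x| <= e].
  move=> e0; have e20 : 0 < e / 2 by rewrite divr_gt0.
  have [f Ff] := near_const (e / 2) e20.
  have fl x : `|f x - l x| <= e / 2.
    rewrite leNgt; apply/negP => fl.
    have e' : 0 < `|f x - l x| - e / 2 by rewrite subr_gt0.
    have /cvgrPdist_lt/(_ _ e') Fl := l_lim x.
    have [g [gf gl]] := @filter_ex _ F _ _ (filterI Ff Fl).
    have := gf x; move: gl => /=; have := ler_distD (g x) (f x) (l x).
    by rewrite (distrC (l x)) (distrC (f x) (g x)); lra.
  apply: filterS Ff => g gf x; rewrite (splitr e).
  by apply: le_trans (ler_distD (f x) _ _) _; rewrite lerD // ltW.
have cl : continuous (l : K -> R^o).
  move=> x; apply/cvgrPdist_le => e e0.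
  have e30 : 0 < e / 3 by rewrite divr_gt0.
  have [g gl] := @filter_ex _ F _ _ (l_unif (e / 3) e30).
  have := @cfun_continuous R K cK g x => /cvgrPdist_le/(_ _ e30).
  apply: filterS => y gxy.
  have := gl x; have := gl y; move: gxy; rewrite !ler_norml; lra.
have lP : (l : K -> R^o) \in cts_pred by rewrite inE.
apply/cvg_ex; exists (CFun cK lP); apply/cvgrPdist_le => e e0.
apply: filterS (l_unif e e0) => g gl.
by rewrite distrC; apply: cfun_norm_le => [|x]; [exact: ltW|exact: gl].
Qed.

Lemma submod_complete (Phi : submodClosed CK) (F : set_system (submod Phi)) :
  closed [set f : CK | f \in Phi] -> ProperFilter F -> cauchy F -> cvg F.
Proof.
move=> Phi_closed FF /cauchyP F_cauchy.
pose G : set_system CK := (fun phi : submod Phi => val phi) @ F.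
have FG : ProperFilter G by exact: fmap_proper_filter.
have /cvg_ex[f Gf] : cvg G.
  apply: cfun_complete; apply/cauchyP => e e0.
  have [phi Fphi] := F_cauchy e e0; exists (val phi).
  by move: Fphi; rewrite -!ball_normE.
have fP : f \in Phi.
  apply: (@closed_cvg _ _ G _ id [set f : CK | f \in Phi]) => //.
  by apply: (@filterE _ F) => phi; exact: valP.
apply/cvg_ex; exists (SubMod fP); apply/cvgrPdist_le => e e0.
by move/cvgrPdist_le : Gf => /(_ e e0).
Qed.

End ContinuousFunctionsOnCompact.

(** * Density of the functions with a strict maximum *)

Lemma far_closed (R : realType) (K : metricType R) (r : R) :
  closed [set p : K * K | r <= mdist p.1 p.2].
Proof.
rewrite -openC openE => -[x y] /= /negP; rewrite -ltNge => xyr.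
pose e := (r - mdist x y) / 2.
have e0 : 0 < e by rewrite divr_gt0 // subr_gt0.
exists (ball x e, ball y e); first by split; exact: nbhsx_ballx.
move=> [x' y'] /= []; rewrite !ballEmdist /= => xx' yy'.
apply/negP; rewrite -ltNge.
have := metric_triangle x' x y'; have := metric_triangle x y y'.
rewrite (metric_sym x' x); rewrite /e in xx' yy'; lra.
Qed.

Section Exposed.
Context {R : realType} {K : metricType R} {cK : compact [set: K]}.
Local Notation CK := (cfun R cK).
Variable Phi : submodClosed CK.
Hypothesis K0 : [set: K] !=set0.
Hypothesis Phi_closed : closed [set f : CK | f \in Phi].
Hypothesis Phi_separates : forall x y : K, x <> y ->
  exists2 f : CK, f \in Phi & f x <> f y.
Implicit Types (f g : CK) (x y k : K) (phi psi : submod Phi).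

Definition strict_max f k := forall y, y <> k -> f y < f k.

(** Baire's theorem in [Phi]: a function whose almost-maximisers are, for every
    [n], less than [1 / (n + 1)] apart has only one maximiser. *)
Lemma strict_max_dense f (eps : R) : f \in Phi -> 0 < eps ->
  exists2 g, g \in Phi & `|g - f| < eps /\ exists k, strict_max g k.
Proof.
move=> fP eps0.
pose far n := [set p : K * K | n.+1%:R^-1 <= mdist p.1 p.2 :> R].
have cfar n : compact (far n).
  apply: (subclosed_compact _ (compact_setX cK cK)); last by [].
  exact: far_closed.
have far_diag n x : ~ far n (x, x).
  by rewrite /far /= mdistxx; apply/negP; rewrite -ltNge.
pose U n : set (submod Phi) := [set phi | max_separates (far n) (val phi)].
(* Completeness depends on the hypothesis [Phi_closed], hence a local
   structure. *)
pose V : completeNormedModType R := HB.pack (submod Phi)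
  (Uniform_isComplete.Build (submod Phi)
    (fun F => submod_complete Phi F Phi_closed)).
have U_open n : open (U n).
  rewrite openE => phi /max_separates_open[r r0 rU]; apply/nbhs_ballP.
  exists r => // psi; rewrite -ball_normE /= distrC => phipsi.
  exact: rU phipsi.
have U_dense n : dense (U n : set V).
  move=> O [phi Ophi]; rewrite openE => /(_ phi Ophi)/nbhs_ballP[r /= r0 rO].
  have [g gP [gphi gU]] := max_separates_dense Phi K0 Phi_separates (far n)
    (val phi) r (cfar n) (far_diag n) (valP phi) r0.
  exists (SubMod gP); split => //; apply: rO.
  by rewrite -ball_normE /= distrC.
have UV n : open (U n : set V) /\ dense (U n : set V) by [].
have /(_ (ball (SubMod fP : V) eps))[||psi [psif psiU]] := @Baire R V U UV.
- by exists (SubMod fP); exact: ballxx.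
- exact: ball_open.
exists (val psi); first exact: valP.
split; first by move: psif; rewrite -ball_normE /= distrC.
have [k kmax] := cfun_argmax (val psi) K0; exists k => y yk.
rewrite ltNge; apply/negP => psiky.
have kn0 : 0 < mdist k y by rewrite mdist_gt0 eq_sym; exact/eqP.
have [n nk] : exists n : nat, n.+1%:R^-1 <= mdist k y.
  exists (Num.truncn (mdist k y)^-1).
  by rewrite invf_ple ?posrE // ltW // truncnS_gt.
have [d d0 psid] := psiU n I.
apply: (psid k y nk) => z.
  by rewrite (le_trans (kmax z)) // lerDl ltW.
by rewrite (le_trans (kmax z)) // (le_trans psiky) // lerDl ltW.
Qed.

Lemma exposed_almost_max f x (eps : R) : f \in Phi -> 0 < eps ->
  exists2 k, exposed Phi k & f x - eps <= f k.
Proof.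
move=> fP eps0; have e0 : 0 < eps / 2 by rewrite divr_gt0.
have [g gP [gf [k kmax]]] := strict_max_dense f (eps / 2) fP e0.
exists k; first by exists g.
have gxk : g x <= g k.
  by have [->//|/eqP xk] := eqVneq x k; exact/ltW/kmax.
have := le_trans (cfun_le_norm (g - f) x) (ltW gf).
have := le_trans (cfun_le_norm (g - f) k) (ltW gf).
rewrite !ler_norml.
have -> : (g - f) x = g x - f x by [].
have -> : (g - f) k = g k - f k by [].
by lra.
Qed.

Lemma norm_attained f : exists x, `|f| = f x \/ `|f| = - f x.
Proof.
have [x xmax] := cfun_argmax f K0; have [y ymin] := cfun_argmax (- f) K0.
have fle : `|f| <= Num.max (f x) (- f y).
  apply: cfun_norm_le => [|z].
    have := ymin x; have -> : (- f) x = - f x by [].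
    by rewrite le_max; case: (leP 0 (f x)) => //= fx0; apply: le_trans; lra.
  rewrite ler_norml lerNl !le_max (xmax z) orbC.
  by have := ymin z; rewrite /= => ->.
have := cfun_le_norm f x; have := cfun_le_norm f y; rewrite !ler_norml.
move: fle; rewrite le_max => /orP[fx|fy] /andP[y1 y2] /andP[x1 x2].
  by exists x; left; apply: le_anti; rewrite fx.
by exists y; right; apply: le_anti; rewrite fy lerNl.
Qed.

(** * Exposed points of the dual ball *)

Lemma delta_dual_ball k : dual_ball _ (delta Phi k).
Proof.
apply/dual_ballP => phi.
exact: le_trans (ler_norm _) (cfun_le_norm (val phi) k).
Qed.

Lemma pm_delta_dual_ball (A : set K) : pm_delta Phi A `<=` dual_ball _.
Proof.
by move=> _ [[k _ <-]|[k _ <-]]; [|apply: dual_ballN]; exact: delta_dual_ball.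
Qed.

Lemma pm_delta_exposed_norming phi (eps : R) : 0 < eps ->
  exists2 P, pm_delta Phi (exposed Phi) P & `|phi| - eps <= P phi.
Proof.
move=> eps0; have [x [phix|phix]] := norm_attained (val phi).
  have [k ke] := exposed_almost_max (val phi) x eps (valP phi) eps0.
  rewrite -phix => phik; exists (delta Phi k) => //.
  by left; exists k.
have nP : - val phi \in Phi by rewrite -scaleN1r rpredZ //; exact: valP.
have [k ke phik] := exposed_almost_max (- val phi) x eps nP eps0.
exists (- delta Phi k); first by right; exists k.
have -> : `|phi| = (- val phi : CK) x by exact: phix.
exact: phik.
Qed.

(** The upper bound in Danskin's formula for the derivative at [t = 0] of the
    maximum of [f + t g], when [f] has a strict maximum: near [k] the
    continuity of [g] suffices, and away from [k] the gap [f k - f x] absorbs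
    the perturbation. *)
Lemma strict_max_directional f g k (eps : R) : strict_max f k -> 0 < eps ->
  \forall t \near (0 : R)^'+, forall x,
    f x + t * g x <= f k + t * g k + t * eps.
Proof.
move=> kmax eps0.
have /compact_near_coveringP cK' := cK.
have cf := @cfun_continuous R K cK f; have cg := @cfun_continuous R K cK g.
have kmax' y : f y <= f k.
  by have [->//|/eqP yk] := eqVneq y k; exact/ltW/kmax.
suff : \forall t \near (0 : R)^'+, [set: K] `<=`
    [set x | f x + t * g x <= f k + t * g k + t * eps].
  by apply: filterS => t le_t x; exact: le_t.
apply: cK' => x _.
have [->|/eqP xk] := eqVneq x k.
  have gk : g k < g k + eps by rewrite ltrDl.
  exists ([set y | g y < g k + eps], [set t : R | 0 < t]).
    split; last exact: nbhs_right_gt.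
    exact: (cg k _ (lt_nbhsl gk)).
  move=> [y t] /= [gy t0]; have := kmax' y.
  have : t * g y <= t * (g k + eps) by rewrite ler_wpM2l // ltW.
  by rewrite mulrDr; lra.
pose d := (f k - f x) / 2.
have fd : f x < f k - d by rewrite /d; have := kmax x xk; lra.
have d0 : 0 < d by rewrite divr_gt0 // subr_gt0 kmax.
exists ([set y | f y < f k - d], [set t : R | 0 < t /\ t * (2 * `|g| + 1) < d]).
  split; first exact: (cf x _ (lt_nbhsl fd)).
  have g1 : 0 < 2 * `|g| + 1 by rewrite ltr_wpDl // mulr_ge0.
  near=> t; split => //; rewrite -ltr_pdivlMr //; near: t.
  by apply: nbhs_right_lt; rewrite divr_gt0.
move=> [y t] /= [fy [t0 td]].
have := cfun_le_norm g y; have := cfun_le_norm g k.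
rewrite !ler_norml => /andP[gk _] /andP[_ gy].
have : t * g y <= t * `|g| by rewrite ler_wpM2l // ltW.
have : t * - `|g| <= t * g k by rewrite ler_wpM2l // ltW.
have : 0 < t * eps by rewrite mulr_gt0.
move: td; rewrite mulrDr mulr1; lra.
Unshelve. all: by end_near. Qed.

Hypothesis Phi_constants : forall c : R, cfun_cst cK c \in Phi.

(** After adding a constant, the exposing function [g] is at least [1], so its
    norm is its maximum, also for small perturbations [g + t eta].  If [Q] is
    norming for [g], then [Q eta] is at most the derivative of the norm at [g]
    in the direction [eta], which is [eta k]; using [- eta] gives equality. *)
Lemma exposed_delta k : exposed Phi k ->
  exists phi, forall Q, dual_ball _ Q -> delta Phi k phi <= Q phi ->
    Q = delta Phi k.
Proof.
move=> [f fP kmax].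
pose g := f + cfun_cst cK (`|f| + 1).
have gE x : g x = f x + (`|f| + 1) by [].
have gP : g \in Phi by rewrite rpredD.
have gmax : strict_max g k by move=> y yk; rewrite !gE ltrD2r; exact: kmax.
have g1 x : 1 <= g x.
  by rewrite gE; have := cfun_le_norm f x; rewrite ler_norml; lra.
exists (SubMod gP) => Q /dual_ballP BQ Qg.
suff Qle (eta : submod Phi) : Q eta <= delta Phi k eta.
  apply/val_inj/funext => eta; apply/le_anti; rewrite Qle /=.
  by rewrite -lerN2 -!linearN; exact: Qle.
apply/ler_addgt0Pr => eps eps0.
have [t [[t0 tn] gt]] : exists t : R, (0 < t /\ t * (`|eta| + 1) < 1) /\
    forall x, g x + t * (val eta : CK) x <=
      g k + t * (val eta : CK) k + t * eps.
  have n1 : 0 < `|eta| + 1 by rewrite ltr_wpDl.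
  apply: (@filter_ex _ (0:R)^'+); near=> t; split.
    by split => //; rewrite -ltr_pdivlMr //; near: t; apply: nbhs_right_lt;
      rewrite divr_gt0.
  by near: t; exact: strict_max_directional.
have := BQ (SubMod gP + t *: eta).
have norm_le : `|SubMod gP + t *: eta| <= g k + t * (val eta : CK) k + t * eps.
  have gtE x : (g + t *: (val eta : CK)) x = g x + t * (val eta : CK) x by [].
  have ge0 x : 0 <= g x + t * (val eta : CK) x.
    have := cfun_le_norm (val eta) x; rewrite ler_norml => /andP[ex _].
    have : t * - `|eta| <= t * (val eta : CK) x by rewrite ler_wpM2l // ltW.
    by have := g1 x; move: tn; rewrite mulrDr mulr1; lra.
  apply: (@cfun_norm_le _ _ _ (g + t *: (val eta : CK))) => [|x].
    exact: le_trans (ge0 k) (gt k).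
  by rewrite gtE ger0_norm.
rewrite linearD /= dualZ => /le_trans/(_ norm_le) Qeta.
rewrite -(ler_pM2l t0) mulrDr.
have Qg' : g k <= Q (SubMod gP) by [].
have Qk : t * Q eta <= t * (val eta : CK) k + t * eps by lra.
exact: Qk.
Unshelve. all: by end_near. Qed.

Lemma delta_inj : injective (delta Phi).
Proof.
move=> x y xy; apply: contrapT => /Phi_separates[f fP]; apply.
by have := congr1 (fun Q : dual (submod Phi) => Q (SubMod fP)) xy.
Qed.

Lemma delta_strict_max phi k :
  (forall P, dual_ball _ P -> P <> delta Phi k -> P phi < delta Phi k phi) ->
  exposed Phi k.
Proof.
move=> kmax; exists (val phi); first exact: valP.
move=> y yk; apply: (kmax (delta Phi y)); first exact: delta_dual_ball.
by move/delta_inj.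
Qed.

Lemma wstar_exposed_dual_ball :
  wstar_exposed (dual_ball (submod Phi)) = pm_delta Phi (exposed Phi).
Proof.
apply/seteqP; split => [Q [BQ [phi Qphi]]|_ [[k ke <-]|[k ke <-]]].
- have Qeq P : dual_ball _ P -> `|phi| = P phi -> Q = P.
    move=> BP Pphi; apply: contrapT => QP.
    have := Qphi P (conj BP (fun PQ => QP (esym PQ))).
    by rewrite -Pphi ltNge (dual_ballP Q).1.
  have [k [phik|phik]] := norm_attained (val phi).
    left; have QE := Qeq _ (delta_dual_ball k) phik.
    exists k => //; apply: (delta_strict_max phi) => P BP PQ.
    by rewrite -QE; apply: Qphi; split => //; rewrite QE.
  right; have QE := Qeq _ (dual_ballN _ (delta_dual_ball k)) phik.
  exists k => //; apply: (delta_strict_max (- phi)) => P BP PQ.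
  have := Qphi (- P); rewrite QE !linearN; apply.
  split; first exact: dual_ballN.
  by move=> /oppr_inj.
- split; first exact: delta_dual_ball.
  have [phi kphi] := exposed_delta k ke; exists phi => P [BP PQ].
  by rewrite ltNge; apply/negP => /(kphi _ BP).
- split; first exact/dual_ballN/delta_dual_ball.
  have [phi kphi] := exposed_delta k ke; exists (- phi) => P [BP PQ].
  rewrite ltNge; apply/negP => Pphi; apply: PQ.
  have := kphi (- P) (dual_ballN _ BP) => <-; first by rewrite opprK.
  move: Pphi.
  have -> : (- delta Phi k : dual (submod Phi)) (- phi) = delta Phi k phi.
    by rewrite linearN; exact: opprK.
  by rewrite linearN.
Qed.

End Exposed.

Theorem theorem3 (R : realType) (K : metricType R)
    (K0 : [set: K] !=set0) (cK : compact [set: K])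
    (Phi : submodClosed (cfun R cK))
    (Phi_closed : closed [set f : cfun R cK | f \in Phi])
    (Phi_separates : forall x y : K, x <> y ->
       exists2 phi : cfun R cK, phi \in Phi & phi x <> phi y)
    (Phi_constants : forall c : R, cfun_cst cK c \in Phi) :
  wstar_exposed (dual_ball (submod Phi)) = pm_delta Phi (exposed Phi) /\
  dual_ball (submod Phi) =
    wstar_closed_conv_hull (pm_delta Phi (exposed Phi)).
Proof.
split; first exact: wstar_exposed_dual_ball.
apply: norming_closed_hull; first exact: pm_delta_dual_ball.
exact: pm_delta_exposed_norming.
Qed.
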